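(* Let $\hat\theta$ be an unbiased estimator of the scalar parameter $\theta$ (that is, $E_\theta(\hat\theta)=\theta$ for all $\theta\in\Theta$) with finite nonzero variance $V(\hat\theta)$, and let $g_{E(\hat\theta)}=\hat\theta(y)-E_\theta(\hat\theta)$. Then at every $\theta$ $$\Lambda(g_{E(\hat\theta)})=\frac{1}{V(\hat\theta)},\qquad \mathrm{Eff}^{\Lambda}(g_{E(\hat\theta)})=\frac{1}{I\cdot V(\hat\theta)},$$ so the $\Lambda$-efficiency of $g_{E(\hat\theta)}$ is exactly the classical variance-based efficiency of $\hat\theta$.
   Context: The model is a smooth one-parameter family of distributions on $\mathcal{Y}$ with common support, parameterized by $\theta$ in an open set $\Theta\subset\mathbb{R}$, with Fisher information $I$ finite and positive. A generalized estimator is a function $g$ on $\mathcal{Y}\times\Theta$ with $E_\theta(g)=0$ for all $\theta$, square-integrable at each $\theta$, and smooth in $\theta$. Its $\Lambda$-information is $\Lambda(g)=(E(g'))^{2}/V(g)$, where $g'=\partial g/\partial\theta$ and expectation and variance are taken at $\theta$; its $\Lambda$-efficiency is $\mathrm{Eff}^{\Lambda}(g)=\Lambda(g)/I$. The classical variance-based efficiency of an unbiased estimator is the ratio of the Cramér–Rao bound $1/I$ to $V(\hat\theta)$. *)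

(* Defs.v *)
From HB Require Import structures.
From mathcomp Require Import all_boot all_order all_algebra.
From mathcomp Require Import all_classical all_reals all_analysis.

Set Implicit Arguments.
Unset Strict Implicit.
Unset Printing Implicit Defensive.

Import Order.TTheory GRing.Theory Num.Theory.
Import numFieldNormedType.Exports.

Local Open Scope classical_set_scope.
Local Open Scope ring_scope.
Local Open Scope ereal_scope.

(* f is C^oo on D, D being an open set *)
Definition smooth_on (R : realType) (D : set R) (f : R -> R) : Prop :=
  forall (n : nat) (t : R), D t -> derivable (derive1n n f) t 1%R.

(* ln takes its default value 0 where pdf vanishes; with a common support the
   score is therefore 0 off the support, which is a null set under every law. *)
Definition score_of (R : realType) (Y : Type) (pdf : R -> Y -> R)
    (t : R) (y : Y) : R :=
  derive1 (fun s : R => ln (pdf s y)) t.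

(* Only the values of law and pdf at parameters in Theta are meaningful. *)
Record smooth_family (d : measure_display) (Y : measurableType d)
    (R : realType) := SmoothFamily {
  Theta : set R ;
  base : {sigma_finite_measure set Y -> \bar R} ;
  law : R -> probability Y R ;
  pdf : R -> Y -> R ;
  Theta_open : open Theta ;
  pdf_ge0 : forall t, Theta t -> forall y, (0 <= pdf t y)%R ;
  pdf_measurable : forall t, Theta t -> measurable_fun setT (pdf t) ;
  pdf_law : forall t, Theta t -> forall A, measurable A ->
    law t A = \int[base]_(y in A) (pdf t y)%:E ;
  common_support : forall s t, Theta s -> Theta t ->
    [set y | (0 < pdf s y)%R] = [set y | (0 < pdf t y)%R] ;
  pdf_smooth : forall y, smooth_on Theta (fun t => pdf t y) ;
  fisher_pos_finite : forall t, Theta t ->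
    0 < 'E_(law t)[fun y => (score_of pdf t y ^+ 2)%R] < +oo
}.

Definition fisher (d : measure_display) (Y : measurableType d) (R : realType)
    (M : smooth_family Y R) (t : R) : \bar R :=
  'E_(law M t)[fun y => (score_of (pdf M) t y ^+ 2)%R].

(* Square integrability (membership in Lfun _ 2) includes measurability. *)
Record generalized_estimator (d : measure_display) (Y : measurableType d)
    (R : realType) (M : smooth_family Y R) (g : Y -> R -> R) : Prop := {
  ge_sqint : forall t, Theta M t -> (fun y => g y t) \in Lfun (law M t) 2%:E ;
  ge_mean0 : forall t, Theta M t -> 'E_(law M t)[fun y => g y t] = 0 ;
  ge_smooth : forall y, smooth_on (Theta M) (g y)
}.

Definition Lambda_info (d : measure_display) (Y : measurableType d)
    (R : realType) (M : smooth_family Y R) (g : Y -> R -> R) (t : R) : \bar R :=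
  'E_(law M t)[fun y => derive1 (g y) t] ^+ 2 / 'V_(law M t)[fun y => g y t].

Definition Lambda_eff (d : measure_display) (Y : measurableType d)
    (R : realType) (M : smooth_family Y R) (g : Y -> R -> R) (t : R) : \bar R :=
  Lambda_info M g t / fisher M t.

(* For measurable T, an expectation equal to a real number entails
   integrability: 'E[T] is infinite as soon as T is not integrable. *)
Definition unbiased (d : measure_display) (Y : measurableType d)
    (R : realType) (M : smooth_family Y R) (T : Y -> R) : Prop :=
  forall t, Theta M t -> 'E_(law M t)[T] = t%:E.

Definition centered (d : measure_display) (Y : measurableType d)
    (R : realType) (M : smooth_family Y R) (T : Y -> R) : Y -> R -> R :=
  fun y t => (T y - fine 'E_(law M t)[T])%R.

Definition cramer_rao_bound (d : measure_display) (Y : measurableType d)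
    (R : realType) (M : smooth_family Y R) (t : R) : \bar R :=
  1 / fisher M t.

Definition classical_eff (d : measure_display) (Y : measurableType d)
    (R : realType) (M : smooth_family Y R) (T : Y -> R) (t : R) : \bar R :=
  cramer_rao_bound M t / 'V_(law M t)[T].

(* Main.v *)
Require Import Defs.
From mathcomp Require Import all_boot all_order all_algebra.
From mathcomp Require Import all_classical all_reals all_analysis.
From mathcomp Require Import measurable_realfun.

(** Unbiasedness identifies the centered estimator with [T y - t] for every
parameter [t] in the parameter set [Theta]. Its derivative in [t] is therefore
the constant -1, whose squared expectation is 1, while subtracting a constant
does not change the variance: hence the numerator of the Lambda-information
is 1 and its denominator is the variance of [T]. Dividing by the Fisher
information then gives both formulas for the efficiency.

Two points need care. The equality with [T y - t] holds only on [Theta], and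
differentiation is local, so openness of [Theta] is what transfers smoothness
and derivatives ([derive1n_eq_on_open]). Moreover the efficiencies are
quotients of extended reals: the inverse of a product splits because the
Fisher information and the variance are both finite and nonzero, and square
integrability of the centered estimator is deduced from finiteness of its
variance ([centered_Lfun2]). *)

Import Order.TTheory GRing.Theory Num.Theory.
Import numFieldNormedType.Exports.

Set Implicit Arguments.
Unset Strict Implicit.

Local Open Scope classical_set_scope.
Local Open Scope ring_scope.
Local Open Scope ereal_scope.

(** Every point of an open set has a neighbourhood on which the two functions
agree, so equality passes from each derivative to the next. *)
Lemma derive1n_eq_on_open (R : realType) (D : set R) (f g : R -> R) (n : nat) :
  open D -> (forall t, D t -> f t = g t) ->
  forall t, D t -> derive1n n f t = derive1n n g t.
Proof.
move=> oD fg; elim: n => [|n IHn] t Dt; first exact: fg.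
rewrite !derive1nS !derive1E; apply: near_eq_derive.
by near=> s; apply: IHn; near: s; exact: open_nbhs_nbhs.
Unshelve. all: by end_near. Qed.

Lemma smooth_on_eq (R : realType) (D : set R) (f g : R -> R) :
  open D -> (forall t, D t -> f t = g t) -> smooth_on D g -> smooth_on D f.
Proof.
move=> oD fg smg n t Dt.
apply: near_eq_derivable (smg n t Dt).
near=> s; apply/esym/(derive1n_eq_on_open n oD fg).
by near: s; exact: open_nbhs_nbhs.
Unshelve. all: by end_near. Qed.

Lemma derive1_subr_id (R : realType) (c : R) :
  derive1 (fun t : R => c - t)%R = cst (-1)%R.
Proof.
by apply/funext => t; rewrite derive1E deriveB// derive_cst derive_id sub0r.
Qed.

Lemma smooth_on_cst (R : realType) (D : set R) (c : R) : smooth_on D (cst c).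
Proof.
move=> n t _; have [a ->] : exists a, derive1n n (cst c) = cst a :> (R -> R).
  elim: n => [|n [a IHn]]; first by exists c.
  by exists 0%R; apply/funext => s; rewrite derive1nS IHn derive1_cst.
exact: derivable_cst.
Qed.

Lemma smooth_on_subr_id (R : realType) (D : set R) (c : R) :
  smooth_on D (fun t : R => c - t)%R.
Proof.
case=> [|n] t Dt; first exact: derivableB.
by rewrite derive1Sn derive1_subr_id; exact: smooth_on_cst.
Qed.

(** Membership in the Lebesgue space of exponent 2 is phrased with the real
power of the absolute value; a finite variance presents itself as a finite
integral of the product of the function with itself. *)
Lemma Lfun2_of_integral_sqr (d : measure_display) (Y : measurableType d)
    (R : realType) (mu : {measure set Y -> \bar R}) (f : Y -> R) :
  measurable_fun setT f -> \int[mu]_y ((f y * f y)%R)%:E < +oo ->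
  f \in Lfun mu 2%:E.
Proof.
move=> mf ffin; rewrite inE; apply/andP; split; rewrite inE//=.
rewrite /finite_norm unlock; apply: poweR_lty.
under eq_integral => y _ do
  rewrite /= powR_mulrn// -normrX ger0_norm ?sqr_ge0// expr2.
exact: ffin.
Qed.

Section centering.
Context (d : measure_display) (Y : measurableType d) (R : realType).
Context (P : probability Y R) (X : {mfun Y >-> R}).
Let c := fine 'E_P[X].

(** The variance is by definition the integral of the square of [X - c]. *)
Lemma centered_Lfun2 : 'V_P[X] < +oo -> (fun y => X y - c)%R \in Lfun P 2%:E.
Proof.
move=> Vfin; apply: Lfun2_of_integral_sqr; first exact: measurable_funB.
by move: Vfin; rewrite /variance covariance.unlock -/c expectation.unlock.
Qed.

(** Under a probability measure constants are square integrable, so the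
constant [c] can be added back. *)
Lemma finite_variance_Lfun2 : 'V_P[X] < +oo -> (X : Y -> R) \in Lfun P 2%:E.
Proof.
move=> /centered_Lfun2 Xc2.
have -> : (X : Y -> R) = ((fun y => X y - c) + cst c)%R.
  by apply/funext => y; rewrite fctE subrK.
by rewrite rpredD ?lee1n//= => _; rewrite Lfun_cst.
Qed.

(** Linearity of the expectation requires [X] to be integrable, which follows
from square integrability since the measure is finite. *)
Lemma expectation_centered : 'V_P[X] < +oo -> 'E_P[fun y => X y - c]%R = 0.
Proof.
move=> /finite_variance_Lfun2 X2.
have X1 : (X : Y -> R) \in Lfun P 1 by rewrite Lfun_subset12 ?fin_num_measure.
rewrite (expectationB X1 (Lfun_cst _ c _)) expectation_cst.
by rewrite fineK ?subee// expectation_fin_num.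
Qed.

Lemma variance_centered : 'V_P[X] < +oo -> 'V_P[fun y => X y - c]%R = 'V_P[X].
Proof. by move=> /finite_variance_Lfun2; exact: varianceD_cst_r. Qed.

End centering.

Section unbiased_estimator.
Context (d : measure_display) (Y : measurableType d) (R : realType).
Context (M : smooth_family Y R) (T : Y -> R) (hT : unbiased M T).

Lemma centered_unbiased y t : Theta M t -> centered M T y t = (T y - t)%R.
Proof. by move=> Mt; rewrite /centered hT. Qed.

Lemma smooth_centered y : smooth_on (Theta M) (centered M T y).
Proof.
apply: (smooth_on_eq (@Theta_open _ _ _ M) (centered_unbiased y)).
exact: smooth_on_subr_id.
Qed.

Lemma derive1_centered y t : Theta M t -> derive1 (centered M T y) t = (-1)%R.
Proof.
move=> Mt; have := derive1n_eq_on_open 1 (@Theta_open _ _ _ M)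
  (centered_unbiased y) Mt.
by rewrite !derive1n1 => ->; rewrite derive1_subr_id.
Qed.

End unbiased_estimator.

Theorem mainTheorem4 (d : measure_display) (Y : measurableType d)
    (R : realType) (M : smooth_family Y R) (T : {mfun Y >-> R})
    (hT : unbiased M T)
    (hV : forall t : R, Theta M t ->
       'V_(law M t)[T] != 0 /\ 'V_(law M t)[T] < +oo) :
  generalized_estimator M (centered M T) /\
  forall t : R, Theta M t ->
    [/\ Lambda_info M (centered M T) t = 1 / 'V_(law M t)[T],
        Lambda_eff M (centered M T) t = 1 / (fisher M t * 'V_(law M t)[T])
      & Lambda_eff M (centered M T) t = classical_eff M T t].
Proof.
split.
  split=> [t /hV[_ Vfin]|t /hV[_ Vfin]|y].
  - exact: centered_Lfun2.
  - exact: expectation_centered.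
  - exact: smooth_centered.
move=> t Mt; have [V0 Vfin] := hV t Mt.
have LV : Lambda_info M (centered M T) t = 1 / 'V_(law M t)[T].
  rewrite /Lambda_info variance_centered//; congr (_ / _).
  under [X in 'E_(_)[X]]eq_fun => y do rewrite (derive1_centered hT)//.
  by rewrite -[X in 'E_(_)[X]]/(cst (-1)%R) expectation_cst -EFin_expe
    sqrrN expr1n.
have /andP[I0 Ifin] := fisher_pos_finite Mt.
have IVinv : (fisher M t * 'V_(law M t)[T])^-1 =
    (fisher M t)^-1 * ('V_(law M t)[T])^-1.
  apply/inveM/fin_inveM_def => //.
  - by rewrite gt_eqF.
  - by rewrite ge0_fin_numE// ltW.
  - by rewrite ge0_fin_numE// variance_ge0.
by split; rewrite // /Lambda_eff /classical_eff /cramer_rao_bound LV ?IVinv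
  !mul1e muleC.
Qed.
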